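(* A numerical semigroup $S\neq\mathbb{N}$ is almost symmetric if and only if it is one half of an almost symmetric numerical semigroup with even type, i.e. if and only if there exists an almost symmetric numerical semigroup $T$ with even type such that $S=\frac{T}{2}$.
   Context: $\mathbb{N}$ denotes the non-negative integers. A numerical semigroup $S$ is a submonoid of $\mathbb{N}$ with $\mathbb{N}\setminus S$ finite; $f(S)=\max(\mathbb{Z}\setminus S)$ is its Frobenius number (so $f(\mathbb{N})=-1$). $\mathrm{PF}(S)=\{x\in\mathbb{Z}\setminus S \mid x+s\in S \text{ for any } s\in S\setminus\{0\}\}$, and the type of $S$ is $|\mathrm{PF}(S)|$. $\mathrm{L}(S)=\{x\in\mathbb{Z} \mid x\notin S,\ f(S)-x\notin S\}$; $S$ is almost symmetric if $\mathrm{L}(S)\subseteq \mathrm{PF}(S)$. $\frac{T}{2}=\{s\in\mathbb{N}\mid 2s\in T\}$. *)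

(* Defs.v *)
From HB Require Import structures.
From mathcomp Require Import all_boot all_order all_algebra.
From mathcomp Require Import finmap.
From mathcomp Require Import boolp classical_sets functions cardinality.

Set Implicit Arguments.
Unset Strict Implicit.
Unset Printing Implicit Defensive.

Import Order.TTheory GRing.Theory Num.Theory.

Local Open Scope classical_set_scope.
Local Open Scope ring_scope.

Definition numerical_semigroup (S : set nat) : Prop :=
  [/\ S 0%N,
      forall s t, S s -> S t -> S (s + t)%N
    & finite_set (~` S)].

Definition int_set (S : set nat) : set int := [set s%:Z | s in S].

Definition is_max (A : set int) (m : int) : Prop :=
  A m /\ forall x, A x -> x <= m.

(* The default value 0 is only used when the maximum does not exist, which
   never happens for a numerical semigroup (frobeniusP). *)
Definition frobenius (S : set nat) : int :=
  xget 0 (is_max (~` int_set S)).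

Definition PF (S : set nat) : set int :=
  [set x | ~ int_set S x /\
           forall s : nat, S s -> s <> 0%N -> int_set S (x + s%:Z)].

(* fset_set sends infinite sets to the empty one, but PF S is finite for
   every numerical semigroup S (finite_PF). *)
Definition semigroup_type (S : set nat) : nat := #|` fset_set (PF S)|.

Definition L (S : set nat) : set int :=
  [set x | ~ int_set S x /\ ~ int_set S (frobenius S - x)].

Definition almost_symmetric (S : set nat) : Prop := L S `<=` PF S.

Definition semigroup_half (T : set nat) : set nat := [set s | T (2 * s)%N].

Lemma int_setE (S : set nat) (n : nat) : int_set S n%:Z <-> S n.
Proof. by split=> [[m Sm [<-]]|Sn] //; exists n. Qed.

Lemma numerical_semigroup_bound (S : set nat) :
  numerical_semigroup S -> exists b : nat, forall n, (b <= n)%N -> S n.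
Proof.
case=> _ _ /finite_seqP[s Ss]; exists (\max_(i <- s) i).+1 => n ltn.
apply: contrapT => nSn; have /= ns : n \in s.
  by have : (~` S) n by []; rewrite Ss.
by have := @leq_bigmax_seq nat s xpredT (fun i => i) n ns isT; rewrite leqNgt ltn.
Qed.

Lemma frobeniusP (S : set nat) :
  numerical_semigroup S -> is_max (~` int_set S) (frobenius S).
Proof.
move=> /numerical_semigroup_bound exb; apply: xgetPex.
have [b bP bmin] : exists2 b : nat, (forall n, (b <= n)%N -> S n) &
    forall c : nat, (forall n, (c <= n)%N -> S n) -> (b <= c)%N.
  have exb' : exists b, `[< forall n, (b <= n)%N -> S n >].
    by case: exb => b bP; exists b; apply/asboolP.
  case: (ex_minnP exb') => b /asboolP bP bmin; exists b => // c cP.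
  by apply: bmin; apply/asboolP.
exists (b%:Z - 1); split.
  case: b bP bmin => [|b] bP bmin; first by case.
  have -> : b.+1%:Z - 1 = b%:Z by rewrite -addn1 PoszD addrK.
  move=> /int_setE Sb; have : (b.+1 <= b)%N.
    apply: bmin => n; rewrite leq_eqVlt => /predU1P[<- //|]; exact: bP.
  by rewrite ltnn.
move=> x nSx; rewrite leNgt; apply/negP => ltx; apply: nSx.
have : b%:Z <= x by rewrite -ltzD1 -ltrBlDr.
by case: x {ltx} => // n; rewrite lez_nat => /bP Sn; apply/int_setE.
Qed.

Lemma frobenius_setT : frobenius setT = -1.
Proof.
have [] : is_max (~` int_set setT) (frobenius setT).
  by apply: frobeniusP; split=> //; rewrite setCT; exact: finite_set0.
case: (frobenius setT) => [n /(_ _)[]|n _]; first by apply/int_setE.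
have N1 : (~` int_set setT) (-1) by case.
by move=> /(_ _ N1); case: n.
Qed.

Lemma finite_PF (S : set nat) : numerical_semigroup S -> finite_set (PF S).
Proof.
move=> nS; have [_ fmax] := frobeniusP nS.
have [b bP] := numerical_semigroup_bound nS.
have sub : PF S `<=` [set i%:Z - b.+1%:Z | i in `I_(b + b).+1].
  move=> x [nSx PFx].
  have ltxb : x < b%:Z.
    rewrite ltNge; apply/negP; case: x nSx {PFx} => // n nSn.
    by rewrite lez_nat => /bP Sn; apply: nSn; apply/int_setE.
  have [m _ mE] : int_set S (x + b.+1%:Z) by apply: PFx; [exact: bP|].
  exists m; last by rewrite mE addrK.
  by rewrite /= -ltz_nat mE -addnS PoszD ltrD2r.
by apply: (sub_finite_set sub); apply: finite_image; exact: finite_II.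
Qed.

(* Main.v *)
Require Import Defs.
From mathcomp Require Import all_boot.
From mathcomp Require Import all_order all_algebra finmap.
From mathcomp Require Import boolp cardinality.
From mathcomp Require Import zify.
From mathcomp Require Import classical_sets.

(** For an almost symmetric [S], [PF S] is the disjoint union of [L S] and
    [{f(S)}], and [L S] is stable under the involution [x |-> f(S) - x], whose
    only possible fixed point is [f(S)/2]; hence the type is even iff [f(S)] is
    even. If [f(T)] is even then [f(T/2) = f(T)/2] and [2 L(T/2)] is contained
    in [L T], so almost symmetry passes from [T] to [T/2]. Conversely, given an
    almost symmetric [S] with [k = f(S) >= 0], let [T] be the union of [2 S] and
    the odd numbers greater than [k]. Then [f(T) = 2k], and [L T] consists of
    [2 L(S)] together with [k] itself when [k] is odd. *)

Set Implicit Arguments.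
Unset Strict Implicit.
Unset Printing Implicit Defensive.

Import Order.TTheory GRing.Theory Num.Theory.

Local Open Scope classical_set_scope.
Local Open Scope ring_scope.

Lemma int_set_ge0 (S : set nat) (x : int) : int_set S x -> 0 <= x.
Proof. by case=> n _ <-. Qed.

Lemma int_set_dbl (T : set nat) (x : int) :
  int_set T (x + x) <-> int_set (semigroup_half T) x.
Proof.
case: x => n; last by split=> /int_set_ge0.
by rewrite -PoszD !int_setE /semigroup_half /= mul2n addnn.
Qed.

Lemma lt_frobenius (S : set nat) (x : int) :
  numerical_semigroup S -> frobenius S < x -> int_set S x.
Proof.
move=> /frobeniusP[_ fmax] ltfx; apply: contrapT => /fmax.
by rewrite leNgt ltfx.
Qed.

Lemma frobenius_notin (S : set nat) :
  numerical_semigroup S -> ~ int_set S (frobenius S).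
Proof. by case/frobeniusP. Qed.

Lemma frobenius_eq (S : set nat) (m : int) :
  numerical_semigroup S -> ~ int_set S m ->
  (forall x, m < x -> int_set S x) -> frobenius S = m.
Proof.
move=> nS Sm mS; have [Sf fmax] := frobeniusP nS.
apply/le_anti/andP; split; last exact: fmax.
by rewrite leNgt; apply/negP => /mS.
Qed.

(** The only use of [S <> setT]: a negative Frobenius number would put every natural number in
    [S]. *)
Lemma frobenius_nat (S : set nat) :
  numerical_semigroup S -> S <> setT -> exists k : nat, frobenius S = k%:Z.
Proof.
move=> nS SN; case Ef: (frobenius S) => [k|k]; first by exists k.
case: SN; apply/seteqP; split=> // n _.
by apply/int_setE/lt_frobenius => //; lia.
Qed.

Lemma L_ge0 (S : set nat) (x : int) : numerical_semigroup S -> L S x -> 0 <= x.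
Proof.
move=> nS [_ Sfx]; rewrite leNgt; apply/negP => x0.
by apply: Sfx; apply: lt_frobenius => //; lia.
Qed.

(** If [x] in [PF S] differs from [frobenius S] and [s = frobenius S - x] were in [S], then
    [x + s = frobenius S] would be in [S]. *)
Lemma almost_symmetric_PF (S : set nat) :
  numerical_semigroup S -> almost_symmetric S ->
  PF S = frobenius S |` L S.
Proof.
move=> nS aS; have Sf := frobenius_notin nS.
apply/seteqP; split=> [x [Sx PFx]|x [->|/aS//]].
  have [->|xf] := eqVneq x (frobenius S); [by left | right; split=> //].
  case=> s Ss es; apply: Sf; have -> : frobenius S = x + s%:Z by lia.
  by apply: PFx => // s0; move/eqP: xf; lia.
by split=> // s _ s0; apply: lt_frobenius => //; lia.
Qed.

(** The reflection [x |-> f - x] swaps the elements below and above [f / 2], so these cancel modulo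
    2. *)
Lemma odd_card_reflection (X : {fset int}) (f : int) :
  {in X, forall x, f - x \in X} ->
  odd #|` X| = odd #|` [fset x in X | (x + x == f)%R]%fset|.
Proof.
move=> fX.
pose A := [fset x in X | (x + x < f)%R]%fset.
pose B := [fset x in X | (f < x + x)%R]%fset.
pose C := [fset x in X | (x + x == f)%R]%fset.
have XE : X = (A `|` B `|` C)%fset.
  apply/fsetP => x; rewrite !inE -!andb_orr.
  by case: (ltgtP (x + x) f); rewrite andbT.
have BA : B = [fset (f - x)%R | x in A]%fset.
  apply/fsetP => x; apply/idP/imfsetP => /= [|[y]].
    rewrite !inE => /andP[Xx ltx]; exists (f - x); last by lia.
    by rewrite !inE fX //=; lia.
  by rewrite !inE => /andP[Xy lty] ->; rewrite fX //=; lia.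
have disj (U V : {fset int}) : {in U, forall x, x \notin V} ->
    #|` (U `|` V)%fset| = (#|` U| + #|` V|)%N.
  move=> UV; apply/eqP; rewrite (leq_card_fsetU U V).2.
  by apply/fdisjointP.
have cardB : #|` B| = #|` A|.
  by rewrite BA card_imfset //= => x y /=; lia.
rewrite {1}XE disj => [|x]; last first.
  by rewrite !inE -andb_orr => /andP[-> /=]; lia.
rewrite disj => [|x]; last by rewrite !inE => /andP[-> /=]; lia.
by rewrite cardB addnn oddD odd_double.
Qed.

Lemma even_type (S : set nat) :
  numerical_semigroup S -> almost_symmetric S ->
  (~~ odd (semigroup_type S) <-> exists g : int, frobenius S = g + g).
Proof.
move=> nS aS; have finPF := finite_PF nS.
set f := frobenius S; have PFE : PF S = f |` L S by exact: almost_symmetric_PF.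
have finL : finite_set (L S) by apply: sub_finite_set finPF.
have [S0 _ _] := nS.
have LP x : reflect (L S x) (x \in fset_set (L S)).
  by rewrite in_fset_set //; apply: (iffP idP); rewrite inE.
(* Since [f - f = 0] lies in [S], the union is disjoint and the type is one more than the
   cardinality of [L S]. *)
have fL : f \notin fset_set (L S).
  apply/LP => -[_]; rewrite subrr; apply; exact/int_setE.
rewrite /semigroup_type PFE fset_setU // fset_set1 cardfsU1 fL /= negbK.
rewrite (@odd_card_reflection _ f) => [|x /LP[Sx Sfx]]; last first.
  by apply/LP; split=> //; rewrite subKr.
split=> [|[g fg]].
  case: (fset_0Vmem [fset x in fset_set (L S) | (x + x == f)%R]%fset) => [->|[g]].
    by rewrite cardfs0.
  by rewrite !inE => /andP[_ /eqP <-]; exists g.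
suff -> : [fset x in fset_set (L S) | (x + x == f)%R]%fset = [fset g]%fset.
  by rewrite cardfs1.
have [_ SD _] := nS.
(* The midpoint [g] always belongs to [L S]: otherwise [g + g = f] would lie in [S]. *)
have Sg : ~ int_set S g.
  case=> n Sn ng; apply: (frobenius_notin nS); rewrite -/f fg -ng -PoszD.
  by apply/int_setE/SD.
apply/fsetP => x; rewrite !inE; apply/andP/eqP => [[_ /eqP]|->]; first by lia.
by split; [apply/LP; split=> //; rewrite -/f fg addrK | rewrite fg].
Qed.

Lemma almost_symmetric_half (T : set nat) (g : int) :
  numerical_semigroup T -> numerical_semigroup (semigroup_half T) ->
  frobenius T = g + g -> almost_symmetric T ->
  almost_symmetric (semigroup_half T).
Proof.
move=> nT nS fT aT.
have fS : frobenius (semigroup_half T) = g.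
  apply: frobenius_eq => // [/int_set_dbl|x ltgx].
    by rewrite -fT; exact: frobenius_notin.
  by apply/int_set_dbl/lt_frobenius => //; rewrite fT; lia.
move=> x [Sx]; rewrite fS => Sgx.
(* Reflection commutes with doubling here, because [frobenius T] is twice [g]. *)
have [|_ PFx] := aT (x + x).
  split=> [/int_set_dbl//|]; rewrite fT => Tgx; apply: Sgx; apply/int_set_dbl.
  by have -> : g - x + (g - x) = g + g - (x + x) by lia.
split=> // s Ss s0; apply/int_set_dbl.
have -> : x + s%:Z + (x + s%:Z) = x + x + (2 * s)%N%:Z by lia.
by apply: PFx => //; lia.
Qed.

Definition semigroup_double (S : set nat) (k : nat) : set nat :=
  [set n | if odd n then (k < n)%N : Prop else S n./2].

Lemma semigroup_doubleK (S : set nat) (k : nat) :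
  semigroup_half (semigroup_double S k) = S.
Proof.
apply/seteqP; split=> n; rewrite /semigroup_half /semigroup_double /=;
  by rewrite mul2n odd_double doubleK.
Qed.

Lemma int_set_double_odd (S : set nat) (k : nat) (x : int) :
  int_set (semigroup_double S k) (x + x + 1) <-> k%:Z < x + x + 1.
Proof.
case: x => n; last by split=> [/int_set_ge0|]; lia.
have -> : n%:Z + n%:Z + 1 = n.*2.+1%:Z by lia.
by rewrite ltz_nat int_setE /semigroup_double /= odd_double.
Qed.

Lemma int_set_double_even (S : set nat) (k : nat) (x : int) :
  int_set (semigroup_double S k) (x + x) <-> int_set S x.
Proof. by rewrite -[in X in _ <-> X](semigroup_doubleK S k) int_set_dbl. Qed.

Lemma int_parity (x : int) : exists y, x = y + y \/ x = y + y + 1.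
Proof. by exists (x %/ 2)%Z; lia. Qed.

Section Double.
Variables (S : set nat) (k : nat).
Hypotheses (nS : numerical_semigroup S) (fS : frobenius S = k%:Z).

Let T := semigroup_double S k.

Lemma gt_frobenius_nat (n : nat) : (k < n)%N -> S n.
Proof. by move=> kn; apply/int_setE/lt_frobenius => //; rewrite fS; lia. Qed.

(** Two odd elements exceed [k], so half their sum exceeds [frobenius S] and lies in [S]; a sum of
    mixed parity is odd and still above [k]. *)
Lemma semigroup_double_numerical : numerical_semigroup T.
Proof.
have [S0 SD _] := nS; split=> // [s t|].
  rewrite /T /semigroup_double /= oddD.
  case: (boolP (odd s)) (boolP (odd t)) => os [] ot /= Ts Tt.
  - by apply: gt_frobenius_nat; lia.
  - by lia.
  - by lia.
  - have -> : (s + t)./2 = (s./2 + t./2)%N by lia.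
    exact: SD.
(* From [2k + 2] on, odd numbers exceed [k] and even ones have a half exceeding [k]. *)
apply: sub_finite_set (finite_II k.*2.+2) => n /= Tn.
rewrite ltnNge; apply/negP => len; apply: Tn.
rewrite /T /semigroup_double /=; case: ifP => on; first by lia.
by apply: gt_frobenius_nat; lia.
Qed.

Lemma frobenius_double : frobenius T = k%:Z + k%:Z.
Proof.
apply: frobenius_eq => [||x ltx]; first exact: semigroup_double_numerical.
  by rewrite /T int_set_double_even -fS; exact: frobenius_notin.
have [y [ey|ey]] := int_parity x; rewrite ey in ltx *.
  by rewrite /T int_set_double_even; apply: lt_frobenius => //; rewrite fS; lia.
by apply/int_set_double_odd; lia.
Qed.

Lemma L_double_even (y : int) : L T (y + y) -> L S y.
Proof.
case; rewrite frobenius_double => Ty Tky; split=> [Sy|].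
  by apply: Ty; apply/int_set_double_even.
rewrite fS => Sky; apply: Tky.
have -> : k%:Z + k%:Z - (y + y) = k%:Z - y + (k%:Z - y) by lia.
exact/int_set_double_even.
Qed.

(** An odd number and its reflection in [2k] are both odd; both miss [T] only if neither exceeds
    [k], which forces equality. *)
Lemma L_double_odd (y : int) : L T (y + y + 1) -> y + y + 1 = k%:Z.
Proof.
case; rewrite frobenius_double => Ty Tky; apply/eqP; rewrite eq_le.
apply/andP; split; rewrite leNgt; apply/negP => lty.
  by apply: Ty; apply/int_set_double_odd.
apply: Tky; have -> : k%:Z + k%:Z - (y + y + 1) =
                      k%:Z - y - 1 + (k%:Z - y - 1) + 1 by lia.
by apply/int_set_double_odd; lia.
Qed.

Lemma almost_symmetric_double : almost_symmetric S -> almost_symmetric T.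
Proof.
move=> aS x Tx; split=> [|s Ts s0]; first by case: Tx.
have {}Ts : int_set T s%:Z by apply/int_setE.
have [y [ey|ey]] := int_parity x; have [z [ez|ez]] := int_parity s%:Z;
  rewrite ey ez in Tx Ts *.
- have [_ PFy] := aS _ (L_double_even Tx).
  move/int_set_double_even: Ts => [m Sm em].
  have -> : y + y + (z + z) = y + z + (y + z) by lia.
  by apply/int_set_double_even; rewrite -em; apply: PFy => //; lia.
(* Adding a nonnegative even number keeps an odd element above [k]. *)
- have := L_ge0 nS (L_double_even Tx); move/int_set_double_odd: Ts => kz y0.
  have -> : y + y + (z + z + 1) = y + z + (y + z) + 1 by lia.
  by apply/int_set_double_odd; lia.
(* Here [x = k], and adding a positive even [s] gives an odd number above [k]. *)
- have yk := L_double_odd Tx.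
  have -> : y + y + 1 + (z + z) = y + z + (y + z) + 1 by lia.
  by apply/int_set_double_odd; lia.
(* Again [x = k], while [s > k]: the even sum exceeds [2k], so its half exceeds [frobenius S]. *)
- have yk := L_double_odd Tx; move/int_set_double_odd: Ts => kz.
  have -> : y + y + 1 + (z + z + 1) = y + z + 1 + (y + z + 1) by lia.
  rewrite /T int_set_double_even; apply: lt_frobenius => //; rewrite fS; lia.
Qed.

End Double.

Theorem corollary4p12 (S : set nat)
  (hS : numerical_semigroup S) (hN : S <> setT) :
  almost_symmetric S <->
  exists T : set nat,
    [/\ numerical_semigroup T, almost_symmetric T,
        ~~ odd (semigroup_type T) & S = semigroup_half T].
Proof.
split=> [aS|[T [nT aT eT ST]]].
  have [k fS] := frobenius_nat hS hN.
  have nT := semigroup_double_numerical hS fS.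
  have aT := almost_symmetric_double hS fS aS.
  exists (semigroup_double S k); split=> //.
    apply/(even_type nT aT); exists (Posz k); exact: frobenius_double.
  by rewrite semigroup_doubleK.
have [g fT] := proj1 (even_type nT aT) eT.
by subst S; exact: almost_symmetric_half fT aT.
Qed.
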